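(* For every real number $b\geq 0$, there does not exist a structure of a finite-dimensional topological vector space over $\mathbb R$ on the space $\mathbb H(b)$; that is, there is no finite-dimensional topological vector space over $\mathbb R$ that is homeomorphic to $\mathbb H(b)$.
   Context: For a real number $b\ge 0$, the space of curvilinear Keplerian orbits with angular momentum greater than $b$ is $$\mathbb H(b)=\{(\mathbf c,\mathbf e)\in\mathbb R^3\times\mathbb R^3=\mathbb R^6 : \mathbf c\cdot\mathbf e=0,\ |\mathbf c|>b\},$$ where $\cdot$ is the standard inner product and $|\cdot|$ the Euclidean norm on $\mathbb R^3$. It carries the metric and topology induced from $\mathbb R^6$. *)

(* Defs.v *)
From mathcomp Require Import all_boot all_order all_algebra.
From mathcomp Require Import all_classical all_reals all_analysis.

Set Implicit Arguments.
Unset Strict Implicit.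
Unset Printing Implicit Defensive.

Import Order.TTheory GRing.Theory Num.Theory.
Import numFieldNormedType.Exports.

Local Open Scope classical_set_scope.
Local Open Scope ring_scope.

Definition dot (R : realType) (n : nat) (u v : 'rV[R]_n) : R :=
  \sum_(i < n) u 0 i * v 0 i.

(* The library norm [`|u|] on row vectors is the sup norm, hence this
   definition. *)
Definition euclidean_norm (R : realType) (n : nat) (u : 'rV[R]_n) : R :=
  Num.sqrt (dot u u).

(* R^6 is represented as R^3 x R^3. Coerced to a type, this set carries the
   subspace topology; the product of the sup-norm topologies on R^3 is the
   Euclidean topology of R^6. *)
Definition kepler_orbits (R : realType) (b : R) : set ('rV[R]_3 * 'rV[R]_3) :=
  [set ce | dot ce.1 ce.2 = 0 /\ b < euclidean_norm ce.1].

Definition homeomorphic (X Y : topologicalType) : Prop :=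
  exists (f : X -> Y) (g : Y -> X),
    [/\ cancel f g, cancel g f, continuous f & continuous g].

Definition finite_dimensional (R : realType) (V : lmodType R) : Prop :=
  exists (n : nat) (e : 'I_n -> V),
    forall v : V, exists a : 'I_n -> R, v = \sum_(i < n) a i *: e i.

(* Main.v *)
Require Import Defs.
From mathcomp Require Import all_boot all_order all_algebra.
From mathcomp Require Import all_classical all_reals all_analysis.
From mathcomp Require Import zify ring lra.

Import Order.TTheory GRing.Theory Num.Theory.
Import numFieldNormedType.Exports.

Local Open Scope classical_set_scope.
Local Open Scope ring_scope.

(** A topological vector space contracts to 0 along rays.  The space of orbits
contracts to a 2-sphere instead: for M > b the circular orbits (c, 0) with c on
the sphere of radius M cannot be contracted in it.  The proof turns this into
the nonexistence of a certain map of R^3.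

Throughout, spheres and balls of R^3 are those of the sup norm, so they are
boundaries of cubes, and cubes.  The map c |-> (c, 0) from the sphere of radius M
to the orbits is transported to the vector space V, where it extends to R^3 by
scaling ([continuous_fill]); transported back and projected to the angular
momentum, it becomes a continuous F : R^3 -> R^3 that is the identity on the
sphere and vanishes nowhere, since |c| > b >= 0 for every orbit.

Such an F contradicts the theorem of Poincare and Miranda
([poincare_miranda3]), which is proved by discretization.  If F had no zero in
the cube, then by compactness ([nonvanishing_coordinate_sign]) a grid could be
chosen so fine that on each of its cells some coordinate of F has constant sign.
Label the vertices by the three 0-1 functions a, b, c that say which coordinates
of F are positive.  The cup product da db dc of their coboundaries vanishes on
each cell where one of them is constant ([cup3_eq0]), hence on every cell.  But
da db dc is the coboundary of a db dc, so by a discrete Stokes theorem its sum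
over the cube is a sum over the faces, which the boundary signs of F force to
be 1 ([sum_cup3]).  This cohomological argument takes the place of a Sperner
lemma, and the subdivision into simplices is hidden in the formula for the cup
product. *)

(** * Cup products of coboundaries on a cubical grid *)

(** The value of the cubical cup product dB dC on the unit square with lowest
vertex (y, z): each of the two monotone paths along edges from that vertex to
the opposite one contributes, with a sign, the increment of B on its first edge
times that of C on its second edge. *)
Definition cup2 {K : comNzRingType} (B C : nat -> nat -> K) (y z : nat) : K :=
  (B y.+1 z - B y z) * (C y.+1 z.+1 - C y.+1 z)
  - (B y z.+1 - B y z) * (C y.+1 z.+1 - C y z.+1).

(** The value of dA dB dC on a unit cube, as a signed sum over the six monotone
paths, grouped by the direction of the first edge. *)
Definition cup3 {K : comNzRingType} (A B C : nat -> nat -> nat -> K)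
    (x y z : nat) : K :=
  (A x.+1 y z - A x y z) * cup2 (B x.+1) (C x.+1) y z
  - (A x y.+1 z - A x y z) * cup2 (B ^~ y.+1) (C ^~ y.+1) x z
  + (A x y z.+1 - A x y z)
    * cup2 (fun x y => B x y z.+1) (fun x y => C x y z.+1) x y.

(** Since dB dC = d(B dC), the double sum telescopes to a signed sum of B dC
over the sides of the square; dC is 0 along the sides z = 0 and z = N, and B is 0 on
the side y = 0, so what remains is the total increment of C on the side y = N. *)
Lemma sum_cup2 {K : comNzRingType} (N : nat) (B C : nat -> nat -> K) :
    (forall z, B 0%N z = 0) -> (forall z, B N z = 1) ->
    (forall y, C y 0%N = 0) -> (forall y, C y N = 1) ->
  \sum_(0 <= y < N) \sum_(0 <= z < N) cup2 B C y z = 1.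
Proof.
move=> B0 B1 C0 C1.
pose P y z := B y z * (C y z.+1 - C y z).
pose Q y z := B y z * (C y.+1 z - C y z).
have cup2E y z : cup2 B C y z = (P y.+1 z - P y z) - (Q y z.+1 - Q y z).
  by rewrite /cup2 /P /Q; ring.
under eq_bigr do under eq_bigr do rewrite cup2E.
under eq_bigr do rewrite sumrB telescope_sumr //.
rewrite sumrB exchange_big /=.
under eq_bigr do rewrite telescope_sumr // /P B0 B1 mul1r mul0r subr0.
rewrite telescope_sumr // C0 C1 big1 ?subr0 // => y _.
by rewrite /Q !C0 !C1 !subrr !mulr0 subrr.
Qed.

(** As in the plane, dA dB dC = d(A dB dC) reduces the sum to the faces.  On
each of the faces y = 0, y = N, z = 0, z = N one of B and C is constant, and on
x = 0 the function A is 0; the face x = N is the planar case. *)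
Lemma sum_cup3 {K : comNzRingType} (N : nat)
    (A B C : nat -> nat -> nat -> K) :
    (forall y z, A 0%N y z = 0) -> (forall y z, A N y z = 1) ->
    (forall x z, B x 0%N z = 0) -> (forall x z, B x N z = 1) ->
    (forall x y, C x y 0%N = 0) -> (forall x y, C x y N = 1) ->
  \sum_(0 <= x < N) \sum_(0 <= y < N) \sum_(0 <= z < N) cup3 A B C x y z = 1.
Proof.
move=> A0 A1 B0 B1 C0 C1.
pose P x y z := A x y z * cup2 (B x) (C x) y z.
pose Q x y z := A x y z * cup2 (B ^~ y) (C ^~ y) x z.
pose S x y z :=
  A x y z * cup2 (fun x y => B x y z) (fun x y => C x y z) x y.
have cup3E x y z : cup3 A B C x y z = (P x.+1 y z - P x y z)
    - (Q x y.+1 z - Q x y z) + (S x y z.+1 - S x y z).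
  by rewrite /cup3 /P /Q /S /cup2; ring.
have Q0 x z : Q x 0%N z = 0 by rewrite /Q /cup2 !B0 !subrr !mul0r subrr mulr0.
have QN x z : Q x N z = 0 by rewrite /Q /cup2 !B1 !subrr !mul0r subrr mulr0.
have S0 x y : S x y 0%N = 0 by rewrite /S /cup2 !C0 !subrr !mulr0 subrr mulr0.
have SN x y : S x y N = 0 by rewrite /S /cup2 !C1 !subrr !mulr0 subrr mulr0.
under eq_bigr do under eq_bigr do under eq_bigr do rewrite cup3E.
under eq_bigr do under eq_bigr do
  rewrite big_split sumrB /= (telescope_sumr (S _ _)) // S0 SN subrr addr0.
under eq_bigr do rewrite sumrB [X in _ - X]exchange_big /=.
under eq_bigr do under [X in _ - X]eq_bigr do
  rewrite (telescope_sumr (Q _ ^~ _)) // Q0 QN subrr.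
under eq_bigr do rewrite big1_eq subr0.
rewrite exchange_big /=.
under eq_bigr do rewrite exchange_big /=.
under eq_bigr do under eq_bigr do
  rewrite (telescope_sumr (fun x => P x _ _)) // /P A0 A1 mul1r mul0r subr0.
exact: sum_cup2.
Qed.

Definition cell_constant {T : Type} (A : nat -> nat -> nat -> T) x y z :=
  forall i j k : bool, A (x + i)%N (y + j)%N (z + k)%N = A x y z.

Lemma cup3_eq0 {K : comNzRingType} (A B C : nat -> nat -> nat -> K)
    x y z :
    [\/ cell_constant A x y z, cell_constant B x y z | cell_constant C x y z] ->
  cup3 A B C x y z = 0.
Proof.
have E (D : nat -> nat -> nat -> K) : cell_constant D x y z ->
  (D x.+1 y z = D x y z) * (D x y.+1 z = D x y z) * (D x y z.+1 = D x y z) *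
  (D x.+1 y.+1 z = D x y z) * (D x.+1 y z.+1 = D x y z) *
  (D x y.+1 z.+1 = D x y z) * (D x.+1 y.+1 z.+1 = D x y z).
  move=> cD.
  have := (cD true false false, cD false true false, cD false false true,
    cD true true false, cD true false true, cD false true true,
    cD true true true).
  by rewrite /= !addn1 !addn0.
by case=> /E H; rewrite /cup3 /cup2 !H; ring.
Qed.

(** Otherwise the cup products of the three labels vanish on all cells, although
their sum is 1.  This plays the part of the lemma of Sperner. *)
Lemma no_cell_constant (N : nat) (a b c : nat -> nat -> nat -> bool) :
    (forall y z, ~~ a 0%N y z) -> (forall y z, a N y z) ->
    (forall x z, ~~ b x 0%N z) -> (forall x z, b x N z) ->
    (forall x y, ~~ c x y 0%N) -> (forall x y, c x y N) ->
  ~ (forall x y z, (x < N)%N -> (y < N)%N -> (z < N)%N ->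
     [\/ cell_constant a x y z, cell_constant b x y z | cell_constant c x y z]).
Proof.
move=> a0 a1 b0 b1 c0 c1 const.
(* The labels are read as integers, where 0 <> 1. *)
pose I (d : nat -> nat -> nat -> bool) x y z : int := (d x y z)%:R.
have Ic d x y z : cell_constant d x y z -> cell_constant (I d) x y z.
  by move=> cd i j k; rewrite /I cd.
have I0 (t : bool) : ~~ t -> t%:R = 0 :> int by move/negbTE->.
have I1 (t : bool) : t -> t%:R = 1 :> int by move->.
have /eqP := @sum_cup3 int N (I a) (I b) (I c)
  (fun _ _ => I0 _ (a0 _ _)) (fun _ _ => I1 _ (a1 _ _))
  (fun _ _ => I0 _ (b0 _ _)) (fun _ _ => I1 _ (b1 _ _))
  (fun _ _ => I0 _ (c0 _ _)) (fun _ _ => I1 _ (c1 _ _)).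
rewrite big_nat big1// => x xN; rewrite big_nat big1// => y yN.
rewrite big_nat big1// => z zN; apply: cup3_eq0.
by case: (const x y z xN yN zN) => /Ic;
  [constructor 1 | constructor 2 | constructor 3].
Qed.

(** * The Poincare-Miranda theorem in dimension three *)

Lemma mx_norm_leP {R : realFieldType} {m n : nat} {x : 'M[R]_(m, n)} {M : R} :
  0 <= M -> (`|x| <= M) <-> (forall i j, `|x i j| <= M).
Proof.
move=> M0; rewrite {1}/Num.norm /= mx_normrE; split => [/bigmax_leP[_ H] i j|H].
  exact: (H (i, j)).
by apply/bigmax_leP; split => // -[i j] _; exact: H.
Qed.

(** Near each point of the ball some coordinate is nonzero, hence of constant
sign; compactness makes the size of the neighborhood uniform, as in the Lebesgue
number lemma. *)
Lemma nonvanishing_coordinate_sign {R : realType} {n : nat} (M : R)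
    (F : 'rV[R]_n -> 'rV[R]_n) :
    0 <= M -> continuous F -> (forall x, `|x| <= M -> F x != 0) ->
  exists2 d : R, 0 < d & forall x, `|x| <= M -> exists i,
    (forall y, ball x d y -> 0 < F y 0 i) \/
    (forall y, ball x d y -> F y 0 i < 0).
Proof.
move=> M0 cF F0.
pose P (d : R) (x : 'rV[R]_n) := exists i,
  (forall y, ball x d y -> 0 < F y 0 i) \/ (forall y, ball x d y -> F y 0 i < 0).
have cpt : compact [set x : 'rV[R]_n | `|x| <= M].
  suff -> : [set x : 'rV[R]_n | `|x| <= M] =
      [set x | forall i, `[- M, M]%classic (x ord0 i)].
    by apply: (@rV_compact _ _ (fun=> `[- M, M]%classic)) => i; exact: segment_compact.
  apply/seteqP; split => x /=.
    by move=> /(mx_norm_leP M0) H i; rewrite in_itv /= -ler_norml.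
  move=> H; apply/(mx_norm_leP M0) => i j.
  by rewrite ord1 ler_norml; have := H j; rewrite /= in_itv.
have [|d /= d0 dP] := (compact_near_coveringP _).1 cpt R 0^'+ P _ _; last first.
  exists (d / 2); first by rewrite divr_gt0.
  move=> x xM; apply: (dP (d / 2)) => //=; last by rewrite divr_gt0.
  rewrite sub0r normrN gtr0_norm ?divr_gt0//.
  by rewrite ltr_pdivrMr// ltr_pMr// ltr1n.
move=> x xM.
have [i Fxi0] : exists i, F x 0 i != 0.
  apply/not_existsP => H; move/eqP: (F0 x xM); apply; apply/rowP => i.
  by have := H i; rewrite mxE => /negP; rewrite negbK => /eqP.
have cFi : {for x, continuous (fun y => F y 0 i)}.
  apply: (@continuous_comp _ _ _ F (fun u : 'rV[R]_n => u 0 i)); first exact: cF.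
  exact: coord_continuous.
have [e e0 eP] : exists2 e : R, 0 < e &
    (forall y, ball x e y -> 0 < F y 0 i) \/
    (forall y, ball x e y -> F y 0 i < 0).
  case: (ltgtP 0 (F x 0 i)) Fxi0 => // [pos|neg] _.
    have : nbhs x [set y | 0 < F y 0 i].
      exact: (@cvgr_gt _ _ _ _ (fun y => F y 0 i) _ cFi).
    by move=> /nbhs_ballP[e /= e0 eP]; exists e => //; left.
  have : nbhs x [set y | F y 0 i < 0].
    exact: (@cvgr_lt _ _ _ _ (fun y => F y 0 i) _ cFi).
  by move=> /nbhs_ballP[e /= e0 eP]; exists e => //; right.
have e20 : 0 < e / 2 by rewrite divr_gt0.
near=> x' d => /=.
have bx' y : ball x' d y -> ball x e y.
  move=> x'y; rewrite [e]splitr; apply: (@ball_triangle _ _ x').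
    by near: x'; exact: nbhsx_ballx.
  apply: le_ball x'y; near: d; exact: nbhs_right_le.
by exists i; case: eP => H; [left|right] => y /bx'; exact: H.
Unshelve. all: by end_near. Qed.

(** On the vertices of a fine grid, the labels 0 < F_i separate opposite faces by
the boundary conditions, and on every cell one of them is constant unless F has
a zero. *)
Lemma poincare_miranda3 {R : realType} (M : R) (F : 'rV[R]_3 -> 'rV[R]_3) :
    0 < M -> continuous F ->
    (forall (x : 'rV[R]_3) i, `|x| <= M -> x 0 i = M -> 0 < F x 0 i) ->
    (forall (x : 'rV[R]_3) i, `|x| <= M -> x 0 i = - M -> F x 0 i < 0) ->
  exists2 x, `|x| <= M & F x = 0.
Proof.
move=> M0 cF Fpos Fneg; apply: contrapT => noroot.
have [|d d0 dP] := @nonvanishing_coordinate_sign R 3 M F (ltW M0) cF.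
  by move=> x xM; apply/eqP => Fx; apply: noroot; exists x.
(* A grid of N cells per side, of mesh h < d. *)
pose N := (Num.bound (2 * M / d)).+1.
have N0 : (0 : R) < N%:R by rewrite ltr0n.
have Nd : 2 * M / N%:R < d.
  rewrite ltr_pdivrMr// [d * _]mulrC -ltr_pdivrMr//.
  have /archi_boundP Nb : 0 <= 2 * M / d by rewrite divr_ge0 ?mulr_ge0 ?ltW.
  by apply: lt_le_trans Nb _; rewrite ler_nat.
pose h := 2 * M / N%:R.
have h0 : 0 <= h by rewrite divr_ge0 ?mulr_ge0 ?ltW.
(* The coordinates of the grid points.  The truncation at N keeps all of them in
   the cube, whatever the indices. *)
pose t (k : nat) : R := - M + h * (minn k N)%:R.
have t0 : t 0%N = - M by rewrite /t min0n mulr0 addr0.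
have tN : t N = M by rewrite /t minnn divfK ?lt0r_neq0//; ring.
have tM k : `|t k| <= M.
  have kN : (minn k N)%:R <= N%:R :> R by rewrite ler_nat geq_minr.
  have tkN : t k <= t N by rewrite /t minnn lerD2l ler_wpM2l.
  by rewrite ler_norml -tN tkN tN /t lerDl mulr_ge0.
have tstep u (e : bool) : `|t u - t (u + e)%N| <= h.
  have [dm|dm] : minn (u + e) N = minn u N \/ minn (u + e) N = (minn u N).+1.
    by case: e; lia.
    by rewrite /t dm subrr normr0.
  rewrite /t dm -natr1; set r := _%:R.
  rewrite (_ : _ - _ = - h); last by ring.
  by rewrite normrN ger0_norm.
pose pt (x y z : nat) : 'rV[R]_3 := \row_l t (tnth [tuple x; y; z] l).
have ptM x y z : `|pt x y z| <= M.
  by apply/(mx_norm_leP (ltW M0)) => i l; rewrite mxE.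
have ptball x y z (i j k : bool) :
    ball (pt x y z) d (pt (x + i) (y + j) (z + k))%N.
  rewrite mx_norm_ball /ball_ /=; apply: le_lt_trans Nd.
  apply/(mx_norm_leP h0) => o l; rewrite !mxE.
  by case: l => -[|[|[|//]]] ?; rewrite !(tnth_nth 0%N) /=.
pose label (i : 'I_3) x y z := 0 < F (pt x y z) 0 i.
have label0 i x y z : tnth [tuple x; y; z] i = 0%N -> ~~ label i x y z.
  move=> xi; rewrite -leNgt ltW//; apply: Fneg => //.
  by rewrite mxE xi t0.
have label1 i x y z : tnth [tuple x; y; z] i = N -> label i x y z.
  by move=> xi; apply: Fpos => //; rewrite mxE xi tN.
pose i0 : 'I_3 := ord0; pose i1 : 'I_3 := lift ord0 ord0.
pose i2 : 'I_3 := ord_max.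
apply: (@no_cell_constant N (label i0) (label i1) (label i2));
  try by move=> u v; (apply: label0 || apply: label1).
move=> x y z _ _ _; have [i iP] := dP _ (ptM x y z).
have const : cell_constant (label i) x y z.
  move=> j k l; rewrite /label; case: iP => iP; first by rewrite !iP//; exact: ballxx.
  have neg v : ball (pt x y z) d v -> (0 < F v 0 i) = false.
    by move=> /iP /lt_gtF.
  by rewrite !neg//; exact: ballxx.
have : [\/ i = i0, i = i1 | i = i2].
  case: i {iP const} => -[|[|[|//]]] ilt; [constructor 1|constructor 2|constructor 3];
  exact: val_inj.
by case=> <-; [constructor 1|constructor 2|constructor 3].
Qed.

(** This is the no-retraction theorem for the cube: the boundary signs required
by the Poincare-Miranda theorem are those of the identity. *)
Lemma identity_on_sphere_has_zero {R : realType} (M : R)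
    (F : 'rV[R]_3 -> 'rV[R]_3) :
    0 < M -> continuous F -> (forall x : 'rV[R]_3, `|x| = M -> F x = x) ->
  exists x, F x = 0.
Proof.
move=> M0 cF FE.
have sphere (x : 'rV[R]_3) i : `|x| <= M -> `|x 0 i| = M -> F x = x.
  move=> xM xi; apply: FE; apply/eqP; rewrite eq_le xM -xi.
  by apply: (mx_norm_leP (normr_ge0 x)).1.
have [x i xM xi|x i xM xi|x _ Fx0] := poincare_miranda3 _ F M0 cF.
- by rewrite (sphere x i) ?xi ?gtr0_norm.
- by rewrite (sphere x i) ?xi ?normrN ?gtr0_norm// oppr_lt0.
- by exists x.
Qed.

(** * Filling spheres in a topological vector space *)

(** The vector h x is scaled by a factor that is 1 on the sphere of radius M and
0 on the ball of radius M / 2.  A factor that vanished only at 0 would not make the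
product continuous there, since h may be unbounded near 0. *)
Lemma continuous_fill {R : realType} {U : normedModType R}
    {V : topologicalLmodType R} (M : R) (h : U -> V) :
    0 < M -> (forall x, x != 0 -> {for x, continuous h}) ->
  exists2 k : U -> V, continuous k & forall x, `|x| = M -> k x = h x.
Proof.
move=> M0 ch.
pose s (x : U) : R := Num.max 0 (2 / M * `|x| - 1).
exists (fun x => s x *: h x); last first.
  move=> x xM; rewrite /s xM divfK ?lt0r_neq0// max_r; last by lra.
  by rewrite (_ : 2 - 1 = 1) ?scale1r//; ring.
have cs : continuous s.
  move=> x; apply: (@continuous_max R U (fun=> 0) (fun x => 2 / M * `|x| - 1)).
    exact: cvg_cst.
  apply: cvgB; last exact: cvg_cst.
  by apply: cvgM; [exact: cvg_cst|exact: norm_continuous].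
move=> x; have [x0|x0] := eqVneq x 0; last first.
  apply: (@continuous_comp U (R^o * V)%type V (fun x => (s x, h x))
    (fun z => z.1 *: z.2)); last exact: scale_continuous.
  exact: (cvg_pair (cs x) (ch x x0)).
have xsmall : `|x| < M / 2 by rewrite x0 normr0 divr_gt0.
have near0 : \forall y \near x, s y *: h y = 0.
  have : \forall y \near x, `|y| < M / 2 by apply: cvgr_lt xsmall; exact: norm_continuous.
  apply: filterS => y yM; rewrite /s max_l ?scale0r//.
  rewrite subr_le0 mulrC -ler_pdivlMr ?divr_gt0// invf_div mul1r; exact: ltW.
rewrite /continuous_at (nbhs_singleton near0).
apply: (cvg_trans (near_eq_cvg _) (cvg_cst 0)).
by apply: filterS near0 => y ->.
Qed.

Lemma continuous_radial_projection {R : realType} {U : normedModType R} (r : R)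
    (x : U) :
  x != 0 -> {for x, continuous (fun y => (r / `|y|) *: y)}.
Proof.
move=> x0; apply: cvgZ; last exact: cvg_id.
apply: cvgM; first exact: cvg_cst.
by apply: cvgV; [rewrite normr_eq0|exact: norm_continuous].
Qed.

Lemma continuous_at_comp_initial {Y : choiceType} {X Z : topologicalType}
    (w : Y -> Z) (f : X -> initial_topology w) (x : X) :
  {for x, continuous (w \o f)} -> {for x, continuous f}.
Proof.
move=> cf U [/= _ [[W oW <-]]] /= Wsfx /filterS; apply; apply: cf.
exact: open_nbhs_nbhs.
Qed.

Lemma mx_norm_le_euclidean {R : realType} {n : nat} (u : 'rV[R]_n) :
  `|u| <= euclidean_norm u.
Proof.
apply/mx_norm_leP; first exact: sqrtr_ge0.
move=> i j; rewrite ord1 -sqrtr_sqr ler_wsqrtr// /dot (bigD1 j)//= -expr2.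
by rewrite lerDl sumr_ge0// => l _; rewrite -expr2 sqr_ge0.
Qed.

(** * The space of orbits *)

(** The circular orbits with angular momentum of sup norm M, as a map on R^3 that
is constant along rays. *)
Lemma circular_orbits {R : realType} (b M : R) :
    0 <= b -> b < M ->
  exists2 c : 'rV[R]_3 -> kepler_orbits b,
    forall x : 'rV[R]_3, x != 0 -> {for x, continuous c} &
    forall x : 'rV[R]_3, x != 0 -> set_val (c x) = ((M / `|x|) *: x, 0).
Proof.
move=> b0 bM; have M0 : 0 < M by exact: le_lt_trans bM.
have inH (x : 'rV[R]_3) : b < `|x| -> (x, 0) \in kepler_orbits b.
  move=> bx; apply/mem_set; split; last exact: lt_le_trans (mx_norm_le_euclidean _).
  by rewrite /dot big1// => i _; rewrite mxE mulr0.
have scaleM (x : 'rV[R]_3) : x != 0 -> `|(M / `|x|) *: x| = M.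
  move=> x0; rewrite normrZ gtr0_norm; last by rewrite divr_gt0 ?normr_gt0.
  by rewrite divfK// normr_eq0.
have one0 : const_mx 1 != 0 :> 'rV[R]_3.
  by apply/eqP => /rowP /(_ 0); rewrite !mxE => /eqP; rewrite oner_eq0.
have w : kepler_orbits b.
  by exists ((M / `|const_mx 1 : 'rV[R]_3|) *: const_mx 1, 0); rewrite inH ?scaleM.
pose c (x : 'rV[R]_3) : kepler_orbits b := insubd w ((M / `|x|) *: x, 0).
have cE (x : 'rV[R]_3) : x != 0 -> set_val (c x) = ((M / `|x|) *: x, 0).
  by move=> x0; rewrite set_valE [LHS]insubdK//; apply: inH; rewrite scaleM.
exists c => // x x0; apply: continuous_at_comp_initial.
have near0 : \forall y \near x, y != 0.
  exact: (cvgr_neq0 (F := nbhs x) x cvg_id x0).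
rewrite /prop_for /continuous_at [X in _ --> X]/= (cE _ x0).
pose p (y : 'rV[R]_3) : 'rV[R]_3 * 'rV[R]_3 := ((M / `|y|) *: y, 0).
have cp : {near x, p =1 set_val \o c}.
  by apply: filterS near0 => y y0; rewrite /= cE.
apply: (cvg_trans (near_eq_cvg cp)).
have cr := continuous_radial_projection M x x0.
have c0 : {for x, continuous (fun=> 0 : 'rV[R]_3)} by exact: cst_continuous.
have : {for x, continuous p} by exact: (cvg_pair cr c0).
exact.
Qed.

Theorem theorem1 (R : realType) (b : R) (hb : 0 <= b) :
  ~ exists V : topologicalLmodType R,
      finite_dimensional V /\ homeomorphic V (kepler_orbits b).
Proof.
move=> [V [_ [f [g [_ gK cf cg]]]]].
pose M := b + 1; have M0 : 0 < M by rewrite ltr_wpDl.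
have bM : b < M by rewrite ltrDl.
have [c cc cE] := circular_orbits _ _ hb bM.
have [k ck kE] := @continuous_fill R 'rV[R]_3 V M (g \o c) M0
  (fun x x0 => continuous_comp (cc x x0) (cg _)).
pose F x := (set_val (f (k x))).1.
have FE x : `|x| = M -> F x = x.
  move=> xM; have x0 : x != 0 by rewrite -normr_gt0 xM.
  by rewrite /F kE//= gK cE//= xM divff ?lt0r_neq0// scale1r.
have cF : continuous F.
  move=> x; apply: (@continuous_comp _ _ _ (fun x => set_val (f (k x))) fst);
    last exact: cvg_fst.
  apply: (@continuous_comp _ (kepler_orbits b) _ (f \o k) set_val).
    by apply: continuous_comp; [exact: ck|exact: cf].
  exact: initial_continuous.
have [x Fx0] := identity_on_sphere_has_zero _ F M0 cF FE.
have /set_mem[_] := valP (f (k x)).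
rewrite -/(F x) Fx0 ltNge; apply/negP; rewrite negbK.
by rewrite /euclidean_norm /dot big1 ?sqrtr0// => i _; rewrite mxE mulr0.
Qed.
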